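(* Let $\mathcal{H}$ be a separable Hilbert space (of finite or infinite dimension) over $\mathbb{F}=\mathbb{R}$ or $\mathbb{C}$, let $\mathcal{S}$ be the space of bounded linear operators on $\mathcal{H}$, and let $\mathcal{P}\subset\mathcal{S}$ be the convex set of positive operators. Let $\mathbf{P}\in\mathcal{P}$ and $\mathbf{H}\in\mathcal{S}$. Then $\mathbf{H}$ is an even perturbation of $\mathbf{P}$ in $\mathcal{P}$, i.e. $\mathbf{P}+\mathbf{H}\in\mathcal{P}$ and $\mathbf{P}-\mathbf{H}\in\mathcal{P}$, if and only if $$\mathbf{H}=\sqrt{\mathbf{P}}\,\mathbf{X}\,\sqrt{\mathbf{P}}$$ for some self-adjoint $\mathbf{X}\in\mathcal{S}$ such that $\mathcal{R}(\mathbf{X})\subset\overline{\mathcal{R}(\mathbf{P})}$ and $\|\mathbf{X}\|\le 1$.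
   Context: A bounded linear operator $\mathbf{P}:\mathcal{H}\to\mathcal{H}$ is positive if it is self-adjoint and $\langle x,\mathbf{P}x\rangle\ge 0$ for every $x\in\mathcal{H}$. $\sqrt{\mathbf{P}}$ is the positive square root of $\mathbf{P}$, $\mathcal{R}(\cdot)$ denotes the range of an operator, the bar denotes norm closure in $\mathcal{H}$, and $\|\cdot\|$ is the operator norm. For a convex subset $\mathcal{C}$ of a vector space $\mathcal{V}$ and $p\in\mathcal{C}$, an element $h\in\mathcal{V}$ is called an even perturbation of $p$ in $\mathcal{C}$ if $p+h\in\mathcal{C}$ and $p-h\in\mathcal{C}$. *)

(* Defs.v *)
From HB Require Import structures.
From mathcomp Require Import all_boot all_order all_algebra.
From mathcomp Require Import complex.
From mathcomp Require Import all_classical all_reals all_analysis.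

Set Implicit Arguments.
Unset Strict Implicit.
Unset Printing Implicit Defensive.

Import Order.TTheory GRing.Theory Num.Theory.
Import numFieldNormedType.Exports.

Local Open Scope classical_set_scope.
Local Open Scope ring_scope.

Variant scalar_kind := RealScalars | ComplexScalars.

Definition scalars (R : realType) (F : scalar_kind) : numFieldType :=
  match F with RealScalars => R | ComplexScalars => R[i] end.

Definition conj_scalar (R : realType) (F : scalar_kind) :
    scalars R F -> scalars R F :=
  match F with RealScalars => id | ComplexScalars => @conjc R end.

Definition re_scalar (R : realType) (F : scalar_kind) : scalars R F -> R :=
  match F with RealScalars => id | ComplexScalars => @complex.Re R end.

Arguments conj_scalar {R F}.
Arguments re_scalar {R F}.

Section ConjScalar.
Variables (R : realType) (F : scalar_kind).

Lemma conj_scalar_is_zmod_morphism : zmod_morphism (@conj_scalar R F).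
Proof. by case: F => // x y; exact: (rmorphB (@conjc R)). Qed.

Lemma conj_scalar_is_monoid_morphism : monoid_morphism (@conj_scalar R F).
Proof.
case: F => //; split; first exact: (rmorph1 (@conjc R)).
exact: (rmorphM (@conjc R)).
Qed.

Lemma conj_scalarK : involutive (@conj_scalar R F).
Proof. by case: F => // x /=; rewrite conjcK. Qed.

HB.instance Definition _ :=
  GRing.isZmodMorphism.Build (scalars R F) (scalars R F) conj_scalar
    conj_scalar_is_zmod_morphism.
HB.instance Definition _ :=
  GRing.isMonoidMorphism.Build (scalars R F) (scalars R F) conj_scalar
    conj_scalar_is_monoid_morphism.
HB.instance Definition _ :=
  isInvolutive.Build (scalars R F) conj_scalar conj_scalarK.

End ConjScalar.

(* A Hilbert space is a complete normed module whose norm is induced by a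
   positive definite Hermitian form.  The norm of a normed module over
   [scalars R F] takes its values in [scalars R F]. The form is linear in its
   first argument and conjugate-linear in the second. *)
HB.mixin Record isHilbert (R : realType) (F : scalar_kind) H
    of CompleteNormedModule (scalars R F) H := {
  inner : {dot H for @conj_scalar R F} ;
  inner_norm : forall x : H, inner x x = `|x| ^+ 2
}.

#[short(type="hilbertType")]
HB.structure Definition Hilbert (R : realType) (F : scalar_kind) :=
  {H of CompleteNormedModule (scalars R F) H & isHilbert R F H}.

Definition separable (T : topologicalType) : Prop :=
  exists2 D : set T, countable D & dense D.

Section BoundedOperators.
Variables (R : realType) (F : scalar_kind) (H : hilbertType R F).

Definition bounded_linear : {pred H -> H} :=
  [pred T : H -> H | `[< linear T /\
     exists M : scalars R F, forall x, `|T x| <= M * `|x| >] ].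

Lemma bounded_linear_submod : submod_closed bounded_linear.
Proof.
split.
  apply/asboolP; split; first by move=> a x y; rewrite scaler0 addr0.
  by exists 0 => x; rewrite normr0 mul0r.
move=> a S T /asboolP[linS [M leM]] /asboolP[linT [N leN]].
apply/asboolP; split.
  move=> b x y /=; rewrite [LHS](_ : _ = a *: S (b *: x + y) + T (b *: x + y))//.
  rewrite [X in _ = b *: X + _](_ : _ = a *: S x + T x)//.
  rewrite [X in _ = _ + X](_ : _ = a *: S y + T y)//.
  rewrite linS linT !scalerDr !scalerA mulrC -!addrA; congr (_ + _).
  by rewrite addrCA.
exists (`|a| * M + N) => x.
rewrite [X in `|X|](_ : _ = a *: S x + T x)//.
rewrite (le_trans (ler_normD _ _))// mulrDl lerD// normrZ -mulrA.
by rewrite ler_wpM2l.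
Qed.

HB.instance Definition _ := GRing.isSubmodClosed.Build _ _ bounded_linear
  bounded_linear_submod.

Record bounded_operator := BoundedOperator {
  bop_fun :> H -> H ;
  bop_funP : bop_fun \in bounded_linear
}.

HB.instance Definition _ := [isSub for bop_fun].
HB.instance Definition _ := [Choice of bounded_operator by <:].
HB.instance Definition _ :=
  [SubChoice_isSubLmodule of bounded_operator by <:].

Lemma bop_comp_subproof (S T : bounded_operator) : S \o T \in bounded_linear.
Proof.
case: S T => [S /= /asboolP[linS [M leM]]] [T /= /asboolP[linT [N leN]]].
apply/asboolP; split; first by move=> a x y /=; rewrite linT linS.
exists (`|M| * N) => x /=.
rewrite -mulrA (le_trans (leM _))//.
rewrite -[leLHS]ger0_norm ?(le_trans _ (leM _))//.
by rewrite normrM normr_id ler_wpM2l.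
Qed.

Definition bop_comp (S T : bounded_operator) : bounded_operator :=
  BoundedOperator (bop_comp_subproof S T).

Definition adjoint_to (S T : bounded_operator) : Prop :=
  forall x y : H, inner (T x) y = inner x (S y).

Definition self_adjoint (T : bounded_operator) : Prop := adjoint_to T T.

(* Over complex scalars, [0 <= z] includes the condition that [z] is real. *)
Definition positive_operator : set bounded_operator :=
  [set T | self_adjoint T /\ forall x : H, 0 <= inner x (T x)].

Definition sqrt_operator (P : bounded_operator) : bounded_operator :=
  xget 0 [set Q | positive_operator Q /\ bop_comp Q Q = P].

Definition operator_norm (T : bounded_operator) : R :=
  sup [set re_scalar `|T x| | x in [set x : H | `|x| <= 1]].

End BoundedOperators.

Definition even_perturbation (K : numFieldType) (V : lmodType K) (C : set V)
    (p h : V) : Prop :=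
  C (p + h) /\ C (p - h).

(* Main.v *)
Require Import Defs.
From HB Require Import structures.
From mathcomp Require Import all_boot all_order all_algebra.
From mathcomp Require Import complex ring lra.
From mathcomp Require Import all_classical all_reals all_analysis.

(* Write Q for the square root of P, choose r > 0 with rQ <= 1, and put
   B = 1 - rQ and N_n = r (1 + B + ... + B^(n-1)), so that Q N_n = 1 - B^n.  The
   N_n are an increasing sequence of approximate inverses of Q, and N_n v
   converges as soon as it is bounded.  If P + A and P - A are positive, then
   |<x, A x>| <= |Q x|^2, so the compressions N_n A N_n are self-adjoint
   contractions, and they converge strongly; their limit X satisfies Q X Q = A
   because B^n tends strongly to a projection onto the kernel of Q, which A
   annihilates on both sides.  This replaces the Riesz representation and the
   orthogonal projection.

   Estimates are made with the real inner product Re <x, y>, which has the same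
   self-adjoint and positive operators as <x, y> and lets both scalar fields be
   treated at once.  No uniqueness of the square root is needed: any positive Q
   with Q^2 = P will do. *)

Set Implicit Arguments.
Unset Strict Implicit.
Unset Printing Implicit Defensive.

Import Order.TTheory GRing.Theory Num.Theory.
Import numFieldNormedType.Exports.

Local Open Scope classical_set_scope.
Local Open Scope ring_scope.

(** * Real scalars and real parts in either scalar field *)

Definition real_scalar (R : realType) (F : scalar_kind) : R -> scalars R F :=
  match F with RealScalars => id | ComplexScalars => real_complex R end.
Arguments real_scalar {R F}.

Section RealScalar.
Variables (R : realType) (F : scalar_kind).
Implicit Types (r s : R) (z w : scalars R F).

Lemma re_real_scalar r : re_scalar (real_scalar r : scalars R F) = r.
Proof. by case: F. Qed.

Lemma re_scalarD z w : re_scalar (z + w) = re_scalar z + re_scalar w.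
Proof. by case: F z w => //= -[a b] [c d]. Qed.

Lemma re_scalarN z : re_scalar (- z) = - re_scalar z.
Proof. by case: F z => //= -[a b]. Qed.

Lemma re_real_scalarM r z : re_scalar (real_scalar r * z) = r * re_scalar z.
Proof. by case: F z => //= -[a b] /=; rewrite mul0r subr0. Qed.

Lemma re_conj_scalar z : re_scalar (conj_scalar z) = re_scalar z.
Proof. by case: F z => //= -[a b]. Qed.

Lemma ler_real_scalar r s :
  (real_scalar r <= real_scalar s :> scalars R F) = (r <= s).
Proof. by case: F => //=; rewrite lecR. Qed.

Lemma ltr_real_scalar r s :
  (real_scalar r < real_scalar s :> scalars R F) = (r < s).
Proof. by case: F => //=; rewrite ltcR. Qed.

Lemma real_scalar0 : real_scalar 0 = 0 :> scalars R F.
Proof. by case: F. Qed.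

Lemma real_scalar1 : real_scalar 1 = 1 :> scalars R F.
Proof. by case: F. Qed.

Lemma real_scalarD r s :
  real_scalar (r + s) = real_scalar r + real_scalar s :> scalars R F.
Proof. by case: F => //=; rewrite rmorphD. Qed.

Lemma real_scalarM r s :
  real_scalar (r * s) = real_scalar r * real_scalar s :> scalars R F.
Proof. by case: F => //=; rewrite rmorphM. Qed.

Lemma ge0_real_scalar z : 0 <= z -> z = real_scalar (re_scalar z).
Proof.
by case: F z => //= -[a b] z0 /=; rewrite -[b]/(complex.Im (a +i* b)%C) ger0_Im.
Qed.

(** Over the complex field, [a = 1] reads off the real part and [a = 'i] the negated imaginary
    part. *)
Lemma eq_re_scalarM z w :
  (forall a, re_scalar (a * z) = re_scalar (a * w)) -> z = w.
Proof.
case: F z w => [z w /(_ 1)|[a b] [c d] h]; first by rewrite !mul1r.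
have /= := h 1; have /= := h 'i%C.
by rewrite !mul0r !mul1r !subr0 !sub0r => /oppr_inj -> ->.
Qed.

End RealScalar.

Lemma cvg_dist_le (R : realType) (f g : nat -> R) l :
  (forall n, `|f n - l| <= g n) -> g @ \oo --> (0 : R) -> f @ \oo --> l.
Proof.
move=> fg /cvgr0Pnorm_lt g0; apply/cvgrPdist_lt => e /g0.
apply: filterS => n; apply: le_lt_trans.
by rewrite distrC (le_trans (fg n))// ler_norm.
Qed.

(** * The real inner product, its norm and convergence *)

Section RealInner.
Variables (R : realType) (F : scalar_kind) (H : hilbertType R F).
Implicit Types (r : R) (x y z : H).

Definition rinner x y : R := re_scalar (inner x y).
Definition rnorm x : R := re_scalar `|x|.

Lemma innerC x y : inner x y = conj_scalar (inner y x).
Proof. by rewrite hermC expr0 mul1r. Qed.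

Lemma rinnerC x y : rinner x y = rinner y x.
Proof. by rewrite /rinner innerC re_conj_scalar. Qed.

Lemma rinnerDl x y z : rinner (x + y) z = rinner x z + rinner y z.
Proof. by rewrite /rinner linearDl re_scalarD. Qed.

Lemma rinnerNl x y : rinner (- x) y = - rinner x y.
Proof. by rewrite /rinner linearNl re_scalarN. Qed.

Lemma rinnerZl r x y : rinner (real_scalar r *: x) y = r * rinner x y.
Proof. by rewrite /rinner linearZl_LR re_real_scalarM. Qed.

Lemma rinnerDr x y z : rinner x (y + z) = rinner x y + rinner x z.
Proof. by rewrite !(rinnerC x) rinnerDl. Qed.

Lemma rinnerNr x y : rinner x (- y) = - rinner x y.
Proof. by rewrite !(rinnerC x) rinnerNl. Qed.

Lemma rinnerZr r x y : rinner x (real_scalar r *: y) = r * rinner x y.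
Proof. by rewrite !(rinnerC x) rinnerZl. Qed.

Lemma rinnerBl x y z : rinner (x - y) z = rinner x z - rinner y z.
Proof. by rewrite rinnerDl rinnerNl. Qed.

Lemma rinnerBr x y z : rinner x (y - z) = rinner x y - rinner x z.
Proof. by rewrite rinnerDr rinnerNr. Qed.

Lemma rinner0l x : rinner 0 x = 0.
Proof. by rewrite -(subrr x) rinnerBl subrr. Qed.

Lemma rinner0r x : rinner x 0 = 0.
Proof. by rewrite rinnerC rinner0l. Qed.

Lemma normE x : `|x| = real_scalar (rnorm x).
Proof. exact: ge0_real_scalar. Qed.

Lemma rnorm_ge0 x : 0 <= rnorm x.
Proof. by rewrite -(@ler_real_scalar R F) -normE real_scalar0. Qed.

Lemma rinner_norm x : rinner x x = rnorm x ^+ 2.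
Proof.
by rewrite /rinner inner_norm normE expr2 re_real_scalarM re_real_scalar.
Qed.

Lemma rnormD x y : rnorm (x + y) <= rnorm x + rnorm y.
Proof.
by rewrite -(@ler_real_scalar R F) real_scalarD -!normE ler_normD.
Qed.

Lemma rnormN x : rnorm (- x) = rnorm x.
Proof. by rewrite /rnorm normrN. Qed.

Lemma rnormB x y : rnorm (x - y) <= rnorm x + rnorm y.
Proof. by rewrite -(rnormN y) rnormD. Qed.

Lemma rnorm_distC x y : rnorm (x - y) = rnorm (y - x).
Proof. by rewrite -rnormN opprB. Qed.

Lemma rnorm0 : rnorm 0 = 0.
Proof. by rewrite /rnorm normr0 -real_scalar0 re_real_scalar. Qed.

Lemma rnorm_eq0 x : rnorm x = 0 -> x = 0.
Proof. by move=> x0; apply/normr0_eq0; rewrite normE x0 real_scalar0. Qed.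

Lemma rnormZ r x : 0 <= r -> rnorm (real_scalar r *: x) = r * rnorm x.
Proof.
move=> r0; rewrite /rnorm normrZ ger0_norm ?re_real_scalarM//.
by rewrite -real_scalar0 ler_real_scalar.
Qed.

Lemma rinner_inj x y : (forall z, rinner x z = rinner y z) -> x = y.
Proof.
move=> xy; apply/eqP; rewrite -subr_eq0; apply/eqP/rnorm_eq0.
by apply/eqP; rewrite -sqrf_eq0 -rinner_norm rinnerBl xy subrr.
Qed.

Lemma rinner_CS x y : `|rinner x y| <= rnorm x * rnorm y.
Proof.
have := rnorm_ge0 x; have := rnorm_ge0 y.
rewrite le_eqVlt => /predU1P[/esym/rnorm_eq0 ->|y0].
  by rewrite rinner0r rnorm0 normr0 mulr0.
rewrite le_eqVlt => /predU1P[/esym/rnorm_eq0 ->|x0].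
  by rewrite rinner0l rnorm0 normr0 mul0r.
have N z : 0 <= rinner z z by rewrite rinner_norm sqr_ge0.
(* For both signs, expanding | |y| x ± |x| y |^2 >= 0 gives 2 |x| |y| (|x| |y| ± <x, y>) >= 0, and
   the factor |x| |y| is positive here. *)
have := N (real_scalar (rnorm y) *: x - real_scalar (rnorm x) *: y).
have := N (real_scalar (rnorm y) *: x + real_scalar (rnorm x) *: y).
rewrite !(rinnerBl, rinnerBr, rinnerDl, rinnerDr, rinnerZl, rinnerZr).
rewrite !rinner_norm (rinnerC y x).
have xy0 : 0 < rnorm x * rnorm y by rewrite mulr_gt0.
move=> h1 h2; rewrite ler_norml; apply/andP; split.
  by rewrite -(ler_pM2l xy0); nra.
by rewrite -(ler_pM2l xy0); nra.
Qed.

Lemma cvg_rnormP (u : nat -> H) l :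
  (u @ \oo --> l) <-> ((fun n => rnorm (u n - l)) @ \oo --> (0 : R)).
Proof.
split=> [/cvgrPdist_lt ul|/cvgr0Pnorm_lt ul].
  apply/cvgr0Pnorm_lt => e e0.
  have /ul : 0 < real_scalar e :> scalars R F.
    by rewrite -real_scalar0 ltr_real_scalar.
  apply: filterS => n; rewrite normE ltr_real_scalar rnorm_distC.
  by rewrite ger0_norm ?rnorm_ge0.
apply/cvgrPdist_lt => e e0.
have eE := ge0_real_scalar (ltW e0).
have /ul : 0 < re_scalar e.
  by rewrite -(@ltr_real_scalar R F) -eE real_scalar0.
apply: filterS => n.
rewrite normE [in X in _ -> X]eE ltr_real_scalar rnorm_distC.
by rewrite ger0_norm ?rnorm_ge0.
Qed.

Lemma cvg_squeeze (u : nat -> H) l (f : nat -> R) :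
  (forall n, rnorm (u n - l) <= f n) -> f @ \oo --> (0 : R) -> u @ \oo --> l.
Proof.
move=> uf; move=> /(cvg_dist_le _) f0; apply/cvg_rnormP; apply: f0 => n.
by rewrite subr0 ger0_norm ?rnorm_ge0.
Qed.

Lemma cauchy_rnorm (u : nat -> H) :
  (forall e, 0 < e ->
    exists N, forall n, (N <= n)%N -> rnorm (u N - u n) < e) ->
  exists l : H, u @ \oo --> l.
Proof.
move=> cu; suff : cvgn u by move=> cvu; exists (limn u).
apply: cauchy_cvg; apply: cauchy_exP => e e0.
have eE := ge0_real_scalar (ltW e0).
have /cu [N uN] : 0 < re_scalar e.
  by rewrite -(@ltr_real_scalar R F) -eE real_scalar0.
exists (u N); exists N => // n /= Nn.
by rewrite -ball_normE /= normE eE ltr_real_scalar uN.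
Qed.

Lemma cvg_rinner (u v : nat -> H) l m :
  u @ \oo --> l -> v @ \oo --> m ->
  (fun n => rinner (u n) (v n)) @ \oo --> rinner l m.
Proof.
move=> /cvg_rnormP ul /cvg_rnormP vm.
pose f n := rnorm (u n - l) * (rnorm (v n - m) + rnorm m) +
            rnorm l * rnorm (v n - m).
have f0 : f @ \oo --> (0 : R).
  rewrite [X in _ --> X](_ : 0 = 0 * (0 + rnorm m) + rnorm l * 0);
    last by ring.
  apply: cvgD; first by apply: cvgM => //; apply: cvgD => //; exact: cvg_cst.
  by apply: cvgM => //; exact: cvg_cst.
apply: cvg_dist_le f0 => n.
rewrite (_ : _ - _ = rinner (u n - l) (v n) + rinner l (v n - m)); last first.
  by rewrite rinnerBl rinnerBr; ring.
rewrite (le_trans (ler_normD _ _))// lerD ?rinner_CS//.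
rewrite (le_trans (rinner_CS _ _))// ler_wpM2l ?rnorm_ge0//.
by rewrite (le_trans _ (rnormD _ _))// subrK.
Qed.

Lemma cvg_rnorm (u : nat -> H) l :
  u @ \oo --> l -> (fun n => rnorm (u n)) @ \oo --> rnorm l.
Proof.
move=> /cvg_rnormP; apply: cvg_dist_le => n; rewrite ler_norml.
have := rnormD (u n - l) l; have := rnormD (l - u n) (u n).
by rewrite !subrK rnorm_distC => ? ?; apply/andP; split; lra.
Qed.

Lemma cvg_rnorm_le (u : nat -> H) l c :
  u @ \oo --> l -> (forall n, rnorm (u n) <= c) -> rnorm l <= c.
Proof.
move=> /cvg_rnorm ul uc; apply: (@closed_cvg _ _ \oo _ _ [set t | t <= c]) ul.
  exact: closed_le.
exact: nearW.
Qed.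

End RealInner.

(** * Bounded monotone sequences of numbers and vectors *)

Section MonotoneSequences.
Variables (R : realType).

Lemma nondecreasing_bounded_cauchy (y : nat -> R) c :
  (forall m n, (m <= n)%N -> y m <= y n) -> (forall n, y n <= c) ->
  forall e, 0 < e -> exists N, forall n, (N <= n)%N -> y n - y N < e.
Proof.
move=> ymono yc e e0.
have yub : has_sup (range y).
  split; first by exists (y 0%N), 0%N.
  by exists c => _ [n _ <-].
have [_ [N _ <-] yN] := sup_adherent e0 yub.
exists N => n _; rewrite ltrBlDl -ltrBlDr (le_lt_trans _ yN)// lerB//.
by apply: ub_le_sup; [case: yub | exists n].
Qed.

(** The first hypothesis says <u_m, u_n - u_m> >= 0, whence |u_m - u_n|^2 <= |u_n|^2 - |u_m|^2. The
    squared norms are then increasing and bounded, so [u] is Cauchy. *)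
Lemma cvg_nonneg_increasing (F : scalar_kind) (H : hilbertType R F)
    (u : nat -> H) c :
  (forall m n, (m <= n)%N -> rnorm (u m) ^+ 2 <= rinner (u m) (u n)) ->
  (forall n, rnorm (u n) <= c) -> exists l : H, u @ \oo --> l.
Proof.
move=> umono uc.
have key m n : (m <= n)%N ->
    rnorm (u m - u n) ^+ 2 <= rnorm (u n) ^+ 2 - rnorm (u m) ^+ 2.
  move=> /umono; rewrite -!rinner_norm !(rinnerBl, rinnerBr).
  by rewrite (rinnerC (u n)); lra.
apply: cauchy_rnorm => e e0.
have mono m n : (m <= n)%N -> rnorm (u m) ^+ 2 <= rnorm (u n) ^+ 2.
  by move=> mn; rewrite -subr_ge0 (le_trans _ (key _ _ mn))// sqr_ge0.
have bound n : rnorm (u n) ^+ 2 <= c ^+ 2.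
  by rewrite ler_sqr ?nnegrE ?rnorm_ge0 ?(le_trans (rnorm_ge0 _) (uc n)).
have [N uN] := nondecreasing_bounded_cauchy mono bound (exprn_gt0 2 e0).
exists N => n Nn; rewrite -ltr_sqr ?nnegrE ?rnorm_ge0 ?(ltW e0)//.
by rewrite (le_lt_trans (key _ _ Nn))// uN.
Qed.

End MonotoneSequences.

(** * Bounded operators: strong limits, self-adjointness, positivity *)

Section Operators.
Variables (R : realType) (F : scalar_kind) (H : hilbertType R F).
Implicit Types (S T : bounded_operator H) (x y : H) (r c : R).

Lemma bop_linear T : linear T.
Proof. by have /asboolP[] := bop_funP T. Qed.

HB.instance Definition _ T :=
  GRing.isLinear.Build (scalars R F) H H *:%R T (bop_linear T).

Lemma bopDE S T x : (S + T) x = S x + T x. Proof. by []. Qed.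
Lemma bopNE T x : (- T) x = - T x. Proof. by []. Qed.
Lemma bopZE a T x : (a *: T) x = a *: T x. Proof. by []. Qed.
Lemma bop0E x : (0 : bounded_operator H) x = 0. Proof. by []. Qed.
Lemma bop_compE S T x : bop_comp S T x = S (T x). Proof. by []. Qed.
Definition bopE := (bopDE, bopNE, bopZE, bop0E, bop_compE).

Lemma bop_ext S T : S =1 T -> S = T.
Proof. by move=> ST; apply: val_inj; apply/funext. Qed.

Lemma bop_bounded T :
  exists2 c, 0 < c & forall x, rnorm (T x) <= c * rnorm x.
Proof.
have /asboolP[_ [M TM]] := bop_funP T.
exists (re_scalar `|M| + 1) => [|x].
  rewrite ltr_wpDl// -(@ler_real_scalar R F) real_scalar0.
  by rewrite -ge0_real_scalar.
rewrite -(@ler_real_scalar R F) real_scalarM real_scalarD -!normE.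
rewrite -ge0_real_scalar// real_scalar1 mulrDl mul1r ler_wpDr//.
by rewrite -[`|x|]normr_id -normrM [leRHS]ger0_norm// (le_trans _ (TM _)).
Qed.

Lemma bop_of_linear (f : H -> H) c : linear f ->
  (forall x, rnorm (f x) <= c * rnorm x) -> exists T, bop_fun T = f.
Proof.
move=> linf fc.
have fP : f \in @bounded_linear R F H.
  apply/asboolP; split=> //; exists (real_scalar c) => x.
  by rewrite !normE -real_scalarM ler_real_scalar.
by exists (BoundedOperator fP).
Qed.

Lemma bop_id_subproof : id \in @bounded_linear R F H.
Proof. by apply/asboolP; split=> //; exists 1 => x; rewrite mul1r. Qed.

Definition bop_id := BoundedOperator bop_id_subproof.

Lemma bop_cvg T (u : nat -> H) l :
  u @ \oo --> l -> (fun n => T (u n)) @ \oo --> T l.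
Proof.
have [c c0 Tc] := bop_bounded T.
move=> /cvg_rnormP ul.
apply: (@cvg_squeeze _ _ _ _ _ (fun n => c * rnorm (u n - l))).
  by move=> n; rewrite -linearB Tc.
by rewrite -[X in _ --> X](mulr0 c); apply: cvgM => //; exact: cvg_cst.
Qed.

Lemma strong_limit (T : nat -> bounded_operator H) c :
  (forall n x, rnorm (T n x) <= c * rnorm x) ->
  (forall x, exists l : H, (fun n => T n x) @ \oo --> l) ->
  exists S, forall x, (fun n => T n x) @ \oo --> S x.
Proof.
move=> Tc /choice[f Tf].
have linf : linear f.
  move=> a x y; apply: (cvg_unique _ (Tf _)) => //.
  rewrite (_ : (fun n => _) = (fun n => a *: T n x + T n y)); last first.
    by apply/funext => n; rewrite linearP.
  by apply: cvgD => //; apply: cvgZr.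
have fc x : rnorm (f x) <= c * rnorm x by apply: cvg_rnorm_le (Tf x) _.
by have [S SE] := bop_of_linear linf fc; exists S => x; rewrite SE.
Qed.

(** The uniform bound [c] lets the argument move with [n]: T_n u_n - S l = T_n (u_n - l) + (T_n l -
    S l). *)
Lemma strong_limit_apply (T : nat -> bounded_operator H) S c (u : nat -> H) l :
  (forall n x, rnorm (T n x) <= c * rnorm x) ->
  (forall x, (fun n => T n x) @ \oo --> S x) ->
  u @ \oo --> l -> (fun n => T n (u n)) @ \oo --> S l.
Proof.
move=> Tc /(_ l)/cvg_rnormP TS /cvg_rnormP ul.
apply: (@cvg_squeeze _ _ _ _ _
  (fun n => c * rnorm (u n - l) + rnorm (T n l - S l))) => [n|].
  by rewrite -(subrKA (T n l)) (le_trans (rnormD _ _))// lerD// -linearB Tc.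
rewrite [X in _ --> X](_ : 0 = c * 0 + 0); last by rewrite mulr0 addr0.
by apply: cvgD => //; apply: cvgM => //; exact: cvg_cst.
Qed.

(** Replacing [x] by [a *: x] multiplies both inner products by [a], and their real parts for all
    [a] determine them. *)
Lemma self_adjointP T :
  self_adjoint T <-> forall x y, rinner (T x) y = rinner x (T y).
Proof.
split=> [sT x y|]; first by rewrite /rinner sT.
move=> sT x y; apply: eq_re_scalarM => a.
by have := sT (a *: x) y; rewrite /rinner linearZ !linearZl_LR.
Qed.

Lemma self_adjoint_limit (T : nat -> bounded_operator H) S :
  (forall n, self_adjoint (T n)) ->
  (forall x, (fun n => T n x) @ \oo --> S x) -> self_adjoint S.
Proof.
move=> sT TS; apply/self_adjointP => x y.
apply: (@cvg_unique _ _ ((fun n => rinner (T n x) y) @ \oo)) => //.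
  by apply: cvg_rinner => //; exact: cvg_cst.
rewrite (_ : (fun n => _) = (fun n => rinner x (T n y))); last first.
  by apply/funext => n; rewrite ((self_adjointP _).1 (sT n)).
by apply: cvg_rinner => //; exact: cvg_cst.
Qed.

(** Self-adjointness makes [inner x (T x)] its own conjugate, so its imaginary part vanishes and its
    sign is that of its real part. *)
Lemma positive_operatorP T :
  positive_operator T <->
  (forall x y, rinner (T x) y = rinner x (T y)) /\
  (forall x, 0 <= rinner x (T x)).
Proof.
rewrite -self_adjointP.
have E : self_adjoint T ->
    forall x, (0 <= inner x (T x)) = (0 <= rinner x (T x)).
  move=> sT x; rewrite -(@ler_real_scalar R F) real_scalar0; congr (_ <= _).
  have := innerC x (T x); rewrite sT /rinner.
  case: F (inner x (T x)) => //= -[a b] [/eqP].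
  by rewrite -addr_eq0 -mulr2n mulrn_eq0 => /eqP ->.
by split=> -[sT T0]; split=> // x; have := T0 x; rewrite E.
Qed.

Lemma positive_CS S x y : positive_operator S ->
  rinner x (S y) ^+ 2 <= rinner x (S x) * rinner y (S y).
Proof.
move=> /positive_operatorP[sS S0].
have xyC : rinner y (S x) = rinner x (S y) by rewrite -sS rinnerC.
have key s t : 0 <= s ^+ 2 * rinner x (S x) + s * t * rinner x (S y) *+ 2
    + t ^+ 2 * rinner y (S y).
  have := S0 (real_scalar s *: x + real_scalar t *: y).
  rewrite linearD !linearZ /= !(rinnerDl, rinnerDr, rinnerZl, rinnerZr) xyC.
  by congr (0 <= _); ring.
have := S0 x; have := S0 y; move: key.
set a := rinner x (S x); set b := rinner y (S y); set c := rinner x (S y).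
(* [key] at (b, -c) reads b (a b - c^2) >= 0, and at (-c, a) it reads a (a b - c^2) >= 0. If a = b =
   0, the choice (1, -c) leaves -2 c^2 >= 0. *)
move=> key; rewrite le_eqVlt => /predU1P[b0|b0].
  rewrite le_eqVlt => /predU1P[a0|a0].
    by have := key 1 (- c); rewrite -a0 -b0; lra.
  rewrite -subr_ge0 -(pmulr_rge0 _ a0); have := key (- c) a.
  by congr (0 <= _); ring.
move=> _; rewrite -subr_ge0 -(pmulr_rge0 _ b0); have := key b (- c).
by congr (0 <= _); ring.
Qed.

(* Cauchy-Schwarz for the form <., S .> at the vectors S x and x. *)
Lemma positive_sq_le S c x : positive_operator S ->
  (forall y, rinner y (S y) <= c * rnorm y ^+ 2) ->
  rnorm (S x) ^+ 2 <= c * rinner x (S x).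
Proof.
move=> pS Sc; have [Sx0|n0] := eqVneq (rnorm (S x)) 0.
  by rewrite Sx0 (rnorm_eq0 Sx0) rinner0r mulr0 expr0n.
have {}n0 : 0 < rnorm (S x) ^+ 2 by rewrite exprn_even_gt0.
have := positive_CS (S x) x pS; rewrite rinner_norm.
have [_ /(_ x)] := (positive_operatorP S).1 pS; have := Sc (S x).
move: (rinner x _) (rinner (S x) _) (rnorm _ ^+ 2) n0 => a b n2 n0 bc a0 h.
by rewrite -(ler_pM2l n0); nra.
Qed.

(** The hypothesis means 0 <= 1 + T <= 2, so [positive_sq_le] applies to 1 + T and turns a bound on
    the form into one on the operator. *)
Lemma rnorm_le_of_quadratic_form T x : self_adjoint T ->
  (forall y, `|rinner y (T y)| <= rnorm y ^+ 2) -> rnorm (T x) <= rnorm x.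
Proof.
move=> /self_adjointP sT T1.
have T1' y : - rnorm y ^+ 2 <= rinner y (T y) <= rnorm y ^+ 2.
  by rewrite -ler_norml.
have pS : positive_operator (bop_id + T).
  apply/positive_operatorP; split=> [y z|y]; rewrite !bopE /=.
    by rewrite rinnerDl rinnerDr sT.
  by rewrite rinnerDr rinner_norm; have /andP[] := T1' y; lra.
have S2 y : rinner y ((bop_id + T) y) <= 2 * rnorm y ^+ 2.
  by rewrite !bopE rinnerDr rinner_norm; have /andP[] := T1' y; lra.
(* |(1 + T) x|^2 <= 2 <x, (1 + T) x> simplifies to |T x|^2 <= |x|^2. *)
have := positive_sq_le x pS S2; rewrite !bopE /= -rinner_norm.
rewrite !(rinnerDl, rinnerDr) (rinnerC (T x)) !rinner_norm => h.
by rewrite -ler_sqr ?nnegrE ?rnorm_ge0//; lra.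
Qed.

End Operators.

(** * Existence of a positive square root by iteration *)

Section SquareRoot.
Variables (R : realType) (F : scalar_kind) (H : hilbertType R F).
Implicit Types (P S T : bounded_operator H) (x y : H).

(** The operator recursion below with the number 1 in place of [A]; it increases and stays in
    [0, 1]. *)
Fixpoint sqrt_iter_scalar (R : realType) n : R :=
  if n is n'.+1 then (1 + sqrt_iter_scalar R n' ^+ 2) / 2 else 0.

(* The limit Z solves 2 Z = A + Z^2, so that (1 - Z)^2 = 1 - A.  Increments of
   [sqrt_iter] are dominated in norm by those of [sqrt_iter_scalar]. *)
Fixpoint sqrt_iter (A : bounded_operator H) n : bounded_operator H :=
  if n is n'.+1
  then real_scalar 2^-1 *: (A + bop_comp (sqrt_iter A n') (sqrt_iter A n'))
  else 0.

Local Notation y_ := (sqrt_iter_scalar R).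

Lemma sqrt_iter_scalar_bound n : 0 <= y_ n <= 1.
Proof. by elim: n => [|n /andP[? ?]] /=; apply/andP; split; nra. Qed.

Lemma sqrt_iter_scalar_mono m n : (m <= n)%N -> y_ m <= y_ n.
Proof.
move: m n; apply/nondecreasing_seqP => k.
(* y_(k+1) - y_k = (1 - y_k)^2 / 2. *)
by have := sqr_ge0 (1 - y_ k); rewrite /=; lra.
Qed.

Lemma sqrt_iter0 A x : sqrt_iter A 0 x = 0. Proof. by []. Qed.

Lemma sqrt_iterS A n x : sqrt_iter A n.+1 x =
  real_scalar 2^-1 *: (A x + sqrt_iter A n (sqrt_iter A n x)).
Proof. by []. Qed.

Section Contraction.
Variable A : bounded_operator H.
Hypothesis A_le1 : forall x, rnorm (A x) <= rnorm x.

Local Notation Y := (sqrt_iter A).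

Lemma sqrt_iter_norm n x : rnorm (Y n x) <= y_ n * rnorm x.
Proof.
elim: n x => [|n IH] x; first by rewrite rnorm0 mul0r.
rewrite sqrt_iterS rnormZ ?invr_ge0// /= mulrAC [leRHS]mulrC.
rewrite ler_wpM2l ?invr_ge0//.
rewrite (le_trans (rnormD _ _))// mulrDl mul1r lerD// (le_trans (IH _))//.
by rewrite expr2 -mulrA ler_wpM2l//; have /andP[] := sqrt_iter_scalar_bound n.
Qed.

Lemma sqrt_iter_step n x :
  rnorm (Y n.+1 x - Y n x) <= (y_ n.+1 - y_ n) * rnorm x.
Proof.
elim: n x => [|n IH] x.
  rewrite sqrt_iterS !sqrt_iter0 !subr0 addr0 rnormZ ?invr_ge0//.
  by rewrite /= expr0n addr0 div1r ler_wpM2l ?invr_ge0.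
(* The difference of squares is split as Y_(n+1) (Y_(n+1) - Y_n) + (Y_(n+1) - Y_n) Y_n, which is
   valid without commutation. The scalar increments factor in the same way. *)
have -> : Y n.+2 x - Y n.+1 x = real_scalar 2^-1 *:
    (Y n.+1 (Y n.+1 x - Y n x) + (Y n.+1 (Y n x) - Y n (Y n x))).
  rewrite (sqrt_iterS A n.+1) [in X in _ - X]sqrt_iterS -scalerBr.
  by rewrite (linearB (Y n.+1)) addrA subrK opprD addrACA subrr add0r.
rewrite rnormZ ?invr_ge0//.
have -> : (y_ n.+2 - y_ n.+1) * rnorm x = 2^-1 *
    (y_ n.+1 * ((y_ n.+1 - y_ n) * rnorm x) +
     (y_ n.+1 - y_ n) * (y_ n * rnorm x)) by rewrite /=; field.
rewrite ler_wpM2l ?invr_ge0// (le_trans (rnormD _ _))// lerD//.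
  rewrite (le_trans (sqrt_iter_norm _ _))// ler_wpM2l//.
  by have /andP[] := sqrt_iter_scalar_bound n.+1.
rewrite (le_trans (IH _))// ler_wpM2l ?sqrt_iter_norm//.
by rewrite subr_ge0 sqrt_iter_scalar_mono.
Qed.

Lemma sqrt_iter_dist m n x : (m <= n)%N ->
  rnorm (Y n x - Y m x) <= (y_ n - y_ m) * rnorm x.
Proof.
elim: n => [|n IH].
  by rewrite leqn0 => /eqP ->; rewrite !subrr rnorm0 mul0r.
rewrite leq_eqVlt => /predU1P[->|/IH mn]; first by rewrite !subrr rnorm0 mul0r.
rewrite -(subrKA (Y n x)) (le_trans (rnormD _ _))// mulrBl.
by rewrite -[leRHS](subrKA (y_ n * rnorm x)) -!mulrBl lerD// sqrt_iter_step.
Qed.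

Lemma sqrt_iter_limit :
  exists Z : bounded_operator H, forall x, (fun n => Y n x) @ \oo --> Z x.
Proof.
apply: (@strong_limit _ _ _ _ 1) => [n x|x].
  rewrite (le_trans (sqrt_iter_norm _ _))// ler_wpM2r ?rnorm_ge0//.
  by have /andP[] := sqrt_iter_scalar_bound n.
apply: cauchy_rnorm => e e0.
(* The added 1 keeps the divisor positive when x = 0. *)
have x1 : 0 < rnorm x + 1 by rewrite ltr_wpDl ?rnorm_ge0.
have [||//|N yN] :=
  @nondecreasing_bounded_cauchy R y_ 1 _ _ (e / (rnorm x + 1)).
- exact: sqrt_iter_scalar_mono.
- by move=> n; have /andP[] := sqrt_iter_scalar_bound n.
- by rewrite divr_gt0.
exists N => n Nn; rewrite rnorm_distC (le_lt_trans (sqrt_iter_dist _ Nn))//.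
have := yN _ Nn; rewrite ltr_pdivlMr//.
have : 0 <= y_ n - y_ N by rewrite subr_ge0 sqrt_iter_scalar_mono.
by have := rnorm_ge0 x; nra.
Qed.

End Contraction.

Lemma sqrt_iter_self_adjoint A n :
  self_adjoint A -> self_adjoint (sqrt_iter A n).
Proof.
move=> /self_adjointP sA; elim: n => [|n /self_adjointP IH].
  by apply/self_adjointP => x y; rewrite !sqrt_iter0 rinner0l rinner0r.
apply/self_adjointP => x y; rewrite !sqrt_iterS rinnerZl rinnerZr.
by rewrite rinnerDl rinnerDr sA !IH.
Qed.

(** Since 0 <= P <= 1, the operator 1 - P is a contraction, and the iteration started from it has a
    limit [Z]. The root is 1 - Z, positive because |Z x| <= |x|. *)
Lemma sqrt_exists_le1 P : positive_operator P ->
  (forall x, rinner x (P x) <= rnorm x ^+ 2) ->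
  exists Q, positive_operator Q /\ bop_comp Q Q = P.
Proof.
move=> /positive_operatorP[sP P0] P1.
have sA : self_adjoint (bop_id H - P).
  by apply/self_adjointP => x y; rewrite !bopE rinnerBl rinnerBr sP.
have A1 x : rnorm ((bop_id H - P) x) <= rnorm x.
  apply: rnorm_le_of_quadratic_form => // y; rewrite !bopE rinnerBr rinner_norm.
  have := P0 y; have := P1 y.
  by rewrite ler_norml => ? ?; apply/andP; split; lra.
have [Z YZ] := sqrt_iter_limit A1.
have Z1 x : rnorm (Z x) <= rnorm x.
  apply: cvg_rnorm_le (YZ x) _ => n.
  rewrite (le_trans (sqrt_iter_norm A1 _ _))//.
  by rewrite ler_piMl ?rnorm_ge0//; have /andP[] := sqrt_iter_scalar_bound n.
have sZ := (self_adjointP Z).1 (self_adjoint_limit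
  (fun n => sqrt_iter_self_adjoint n sA) YZ).
(* The recursion passes to the limit; its quadratic term converges because the iterates are
   uniformly bounded. *)
have ZE x : Z x = real_scalar 2^-1 *: ((x - P x) + Z (Z x)).
  apply: (@cvg_unique _ _ ((fun n => sqrt_iter (bop_id H - P) n.+1 x) @ \oo)) => //.
    by have := YZ x; rewrite -cvg_shiftS.
  apply: cvgZr; apply: cvgD; first exact: cvg_cst.
  apply: (strong_limit_apply (c := 1) _ YZ (YZ x)) => n y.
  rewrite (le_trans (sqrt_iter_norm A1 _ _))// ler_wpM2r ?rnorm_ge0//.
  by have /andP[] := sqrt_iter_scalar_bound n.
exists (bop_id H - Z); split.
  apply/positive_operatorP; split=> [x y|x]; rewrite !bopE /=.
    by rewrite rinnerBl rinnerBr sZ.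
  rewrite rinnerBr rinner_norm subr_ge0 (le_trans (ler_norm _))//.
  by rewrite (le_trans (rinner_CS _ _))// expr2 ler_wpM2l ?rnorm_ge0.
apply: bop_ext => x; rewrite !bopE /= linearB.
have : real_scalar 2 *: Z x = (x - P x) + Z (Z x).
  by rewrite [in LHS]ZE scalerA -real_scalarM divff// real_scalar1 scale1r.
rewrite (_ : real_scalar 2 = 2%:R); last first.
  by rewrite -[2]/(1 + 1) real_scalarD real_scalar1.
rewrite scaler_nat mulr2n => ZZ.
apply/eqP; rewrite -subr_eq0 opprB addrACA -opprD ZZ.
by rewrite opprD opprB addrACA subrr addr0 [x + _]addrC subrK subrr.
Qed.

Lemma sqrt_exists P : positive_operator P ->
  exists Q, positive_operator Q /\ bop_comp Q Q = P.
Proof.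
move=> pP; have [c c0 Pc] := bop_bounded P.
have [sP P0] := (positive_operatorP P).1 pP.
(* This [d] satisfies c <= d^2 whatever the size of [c], so P / d^2 <= 1, and [d] times a root of P
   / d^2 is a root of [P]. *)
pose d := 1 + c; have d0 : 0 < d by rewrite /d ltr_wpDr// ltW.
have dd : 0 <= d^-1 ^+ 2 by rewrite exprn_ge0// invr_ge0 ltW.
have [||Q [pQ QP]] := @sqrt_exists_le1 (real_scalar (d^-1 ^+ 2) *: P).
- apply/positive_operatorP; split=> [x y|x]; rewrite !bopE.
    by rewrite rinnerZl rinnerZr sP.
  by rewrite rinnerZr mulr_ge0.
- move=> x; rewrite bopE rinnerZr exprVn mulrC ler_pdivrMr ?exprn_gt0//.
  rewrite (le_trans (ler_norm _))// (le_trans (rinner_CS _ _))//.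
  rewrite expr2 -mulrA ler_wpM2l ?rnorm_ge0// (le_trans (Pc x))// mulrC.
  by rewrite ler_wpM2l ?rnorm_ge0// /d; nra.
have [sQ Q0] := (positive_operatorP Q).1 pQ.
exists (real_scalar d *: Q); split.
  apply/positive_operatorP; split=> [x y|x]; rewrite !bopE.
    by rewrite rinnerZl rinnerZr sQ.
  by rewrite rinnerZr mulr_ge0// ltW.
apply: bop_ext => x; rewrite !bopE linearZ scalerA /=.
rewrite -(bop_compE Q) QP bopE scalerA -!real_scalarM -expr2 -exprMn divff ?gt_eqF//.
by rewrite expr1n real_scalar1 scale1r.
Qed.

(** [sqrt_operator] is a choice with default 0; the existence of a root ensures that the chosen
    value is one. *)
Lemma sqrt_operatorP P : positive_operator P ->
  positive_operator (sqrt_operator P) /\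
  forall x, sqrt_operator P (sqrt_operator P x) = P x.
Proof.
move=> /sqrt_exists /(xgetPex 0)[pQ QP]; split=> // x.
by have /(congr1 (fun T : bounded_operator H => T x)) := QP.
Qed.

End SquareRoot.

(** * Powers of an operator and Neumann partial sums *)

Section NeumannSeries.
Variables (R : realType) (F : scalar_kind) (H : hilbertType R F).
Implicit Types (S T : bounded_operator H) (x y : H).

Fixpoint bop_pow T n : bounded_operator H :=
  if n is n'.+1 then bop_comp T (bop_pow T n') else bop_id H.
Arguments bop_pow : simpl never.

Lemma bop_pow0 T x : bop_pow T 0 x = x. Proof. by []. Qed.

Lemma bop_powS T n x : bop_pow T n.+1 x = T (bop_pow T n x).
Proof. by []. Qed.

Lemma bop_powSr T n x : bop_pow T n.+1 x = bop_pow T n (T x).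
Proof. by elim: n => [|n IH]//; rewrite bop_powS IH. Qed.

Lemma bop_pow_commute S T n x : (forall y, S (T y) = T (S y)) ->
  S (bop_pow T n x) = bop_pow T n (S x).
Proof. by move=> ST; elim: n => [|n IH]//; rewrite !bop_powS ST IH. Qed.

Lemma bop_pow_norm T n x : (forall y, rnorm (T y) <= rnorm y) ->
  rnorm (bop_pow T n x) <= rnorm x.
Proof.
by move=> T1; elim: n => [|n IH]//; rewrite bop_powS (le_trans (T1 _)).
Qed.

Lemma bop_pow_rinner T n x y : self_adjoint T ->
  rinner (bop_pow T n x) y = rinner x (bop_pow T n y).
Proof.
move=> /self_adjointP sT; elim: n x => [|n IH] x //.
by rewrite bop_powSr IH sT bop_powS.
Qed.

(** <x, T^(n+2) x> = <T x, T^n (T x)>, so the induction goes by steps of two from T^0 and T^1. *)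
Lemma bop_pow_ge0 T n x : positive_operator T ->
  0 <= rinner x (bop_pow T n x).
Proof.
move=> pT; have [_ T0] := (positive_operatorP T).1 pT; case: pT => sT _.
elim/ltn_ind: n x => -[|[|n]] IH x.
- by rewrite rinner_norm sqr_ge0.
- exact: T0.
- rewrite bop_powS -((self_adjointP T).1 sT) bop_powSr.
  exact: IH.
Qed.

Fixpoint neumann r T n : bounded_operator H :=
  if n is n'.+1 then neumann r T n' + real_scalar r *: bop_pow T n' else 0.
Arguments neumann : simpl never.

Lemma neumann0 r T x : neumann r T 0 x = 0. Proof. by []. Qed.

Lemma neumannS r T n x :
  neumann r T n.+1 x = neumann r T n x + real_scalar r *: bop_pow T n x.
Proof. by []. Qed.

Lemma neumann_rinner r T n x y : self_adjoint T ->
  rinner (neumann r T n x) y = rinner x (neumann r T n y).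
Proof.
move=> sT; elim: n => [|n IH]; first by rewrite !neumann0 rinner0l rinner0r.
by rewrite !neumannS rinnerDl rinnerDr rinnerZl rinnerZr IH bop_pow_rinner.
Qed.

(** Supplies the hypothesis of [cvg_nonneg_increasing]. Each term added to the right-hand side is
    nonnegative because <T^k x, T^l x> = <x, T^(k+l) x> >= 0. *)
Lemma neumann_increasing r T m n x : 0 <= r -> positive_operator T ->
  (m <= n)%N ->
  rnorm (neumann r T m x) ^+ 2 <= rinner (neumann r T m x) (neumann r T n x).
Proof.
move=> r0 pT; have sT := pT.1.
have pos k l : 0 <= rinner (neumann r T k x) (bop_pow T l x).
  elim: k => [|k IH]; first by rewrite neumann0 rinner0l.
  rewrite neumannS rinnerDl addr_ge0// rinnerZl mulr_ge0//.
  rewrite bop_pow_rinner// (_ : bop_pow T k _ = bop_pow T (k + l) x).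
    exact: bop_pow_ge0.
  by elim: {IH} k => // k IH; rewrite addSn !bop_powS IH.
elim: n => [|n IH]; first by rewrite leqn0 => /eqP ->; rewrite rinner_norm.
rewrite leq_eqVlt => /predU1P[->|/IH mn]; first by rewrite rinner_norm.
by rewrite (le_trans mn)// neumannS rinnerDr rinnerZr lerDl mulr_ge0.
Qed.

End NeumannSeries.

(** * Approximate inverses of a positive operator [Q] *)

Section ApproximateInverse.
Variables (R : realType) (F : scalar_kind) (H : hilbertType R F).
Variables (Q : bounded_operator H) (r : R).
Hypothesis pQ : positive_operator Q.
Hypothesis r0 : 0 < r.
Hypothesis rQ : forall x, r * rinner x (Q x) <= rnorm x ^+ 2.

Let B := bop_id H - real_scalar r *: Q.
Local Notation "'B^ n" := (bop_pow B n) (at level 2, n at level 1).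
Local Notation "'N_ n" := (neumann r B n) (at level 2, n at level 1).

Let BE x : B x = x - real_scalar r *: Q x. Proof. by []. Qed.

Lemma defect_positive : positive_operator B.
Proof.
have [sQ Q0] := (positive_operatorP Q).1 pQ.
apply/positive_operatorP; split=> [x y|x]; rewrite !BE.
  by rewrite rinnerBl rinnerBr rinnerZl rinnerZr sQ.
by rewrite rinnerBr rinnerZr rinner_norm subr_ge0.
Qed.

Lemma defect_norm x : rnorm (B x) <= rnorm x.
Proof.
have [sQ Q0] := (positive_operatorP Q).1 pQ.
apply: rnorm_le_of_quadratic_form; first by case: defect_positive.
move=> y; have [_ /(_ y) B0] := (positive_operatorP B).1 defect_positive.
rewrite ger0_norm// BE rinnerBr rinnerZr rinner_norm gerBl mulr_ge0//.
exact: ltW.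
Qed.

Lemma Q_defect_pow n x : Q ('B^n x) = 'B^n (Q x).
Proof. by apply: bop_pow_commute => y; rewrite !BE linearB linearZ. Qed.

(** The sum telescopes because r Q = 1 - B. *)
Lemma Q_neumann n x : Q ('N_n x) = x - 'B^n x.
Proof.
elim: n => [|n IH]; first by rewrite neumann0 linear0 bop_pow0 subrr.
rewrite neumannS bop_powS BE linearD linearZ /= IH.
by rewrite opprB addrAC addrA.
Qed.

Lemma neumann_Q n x : 'N_n (Q x) = Q ('N_n x).
Proof.
elim: n => [|n IH]; first by rewrite !neumann0 linear0.
by rewrite !neumannS linearD linearZ /= IH Q_defect_pow.
Qed.

(** Q N_n = 1 - B^n lies between 0 and 1, as B^n does. *)
Lemma Q_neumann_norm n x : rnorm (Q ('N_n x)) <= rnorm x.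
Proof.
have E y : Q ('N_n y) = (bop_id H - 'B^n) y by rewrite Q_neumann.
have [sB _] := defect_positive.
rewrite E; apply: rnorm_le_of_quadratic_form => [|y].
  by apply/self_adjointP => y z; rewrite !bopE rinnerBl rinnerBr bop_pow_rinner.
have B0 := bop_pow_ge0 n y defect_positive.
have B1 : rinner y ('B^n y) <= rnorm y ^+ 2.
  rewrite (le_trans (ler_norm _))// (le_trans (rinner_CS _ _))//.
  by rewrite expr2 ler_wpM2l ?rnorm_ge0// bop_pow_norm//; exact: defect_norm.
by rewrite !bopE rinnerBr rinner_norm ger0_norm; lra.
Qed.

Lemma neumann_cvg x c : (forall n, rnorm ('N_n x) <= c) ->
  exists l : H, (fun n => 'N_n x) @ \oo --> l.
Proof.
apply: cvg_nonneg_increasing => m n mn.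
by apply: neumann_increasing => //; [exact: ltW | exact: defect_positive].
Qed.

(** B^n x = x - N_n (Q x), where N_n (Q x) is bounded by |x| and therefore converges. The limit is
    fixed by B = 1 - r Q, hence annihilated by [Q]. *)
Lemma defect_pow_cvg : exists2 M : bounded_operator H,
  forall x, (fun n => 'B^n x) @ \oo --> M x & forall x, Q (M x) = 0.
Proof.
have [n x|x|M BM] := @strong_limit _ _ _ (bop_pow B) 1.
- by rewrite mul1r bop_pow_norm//; exact: defect_norm.
- have [|l Nl] := @neumann_cvg (Q x) (rnorm x).
    by move=> n; rewrite neumann_Q Q_neumann_norm.
  exists (x - l); rewrite (_ : (fun n => _) = (fun n => x - 'N_n (Q x))).
    by apply: cvgB => //; exact: cvg_cst.
  by apply/funext => n; rewrite neumann_Q Q_neumann subKr.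
exists M => // x.
have BMx : B (M x) = M x.
  apply: (@cvg_unique _ _ ((fun n => 'B^n.+1 x) @ \oo)) => //.
    exact: bop_cvg.
  by have := BM x; rewrite -cvg_shiftS.
apply: rnorm_eq0; apply: (mulfI (lt0r_neq0 r0)).
rewrite mulr0 -rnormZ ?ltW// (_ : _ *: _ = M x - B (M x)).
  by rewrite BMx subrr rnorm0.
by rewrite BE subKr.
Qed.

(** * Factoring through [Q] an operator whose form [Q] dominates *)

Variable A : bounded_operator H.
Hypothesis sA : self_adjoint A.
(** The constant 1 here makes the factor a contraction. The off-diagonal bound [A_CS], with an
    arbitrary constant, serves the convergence and the vanishing of [A] on the kernel of [Q]. *)
Hypothesis A_le : forall x, `|rinner x (A x)| <= rnorm (Q x) ^+ 2.
Variable c : R.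
Hypothesis c0 : 0 <= c.
Hypothesis A_CS :
  forall x y, `|rinner x (A y)| <= c * rnorm (Q x) * rnorm (Q y).

Let sAr : forall x y, rinner (A x) y = rinner x (A y).
Proof. exact/self_adjointP. Qed.

Let sB : self_adjoint B. Proof. by case: defect_positive. Qed.

Lemma A_ker_Q x : Q x = 0 -> A x = 0.
Proof.
move=> Qx0; apply: rinner_inj => z; rewrite rinner0l rinnerC.
by apply/eqP; rewrite -normr_le0 (le_trans (A_CS _ _))// Qx0 rnorm0 mulr0.
Qed.

(** For v = N_n A u, |v|^2 = <N_n v, A u> <= c |Q N_n v| |Q u| <= c |v| |Q u|. The bound is uniform
    in [n], although the N_n themselves may grow. *)
Lemma neumann_A_norm n u : rnorm ('N_n (A u)) <= c * rnorm (Q u).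
Proof.
have [->|v0] := eqVneq (rnorm ('N_n (A u))) 0.
  by rewrite mulr_ge0// rnorm_ge0.
have {}v0 : 0 < rnorm ('N_n (A u)) by rewrite lt0r v0 rnorm_ge0.
rewrite -(ler_pM2l v0) -expr2 -rinner_norm -neumann_rinner//.
rewrite (le_trans (ler_norm _))// (le_trans (A_CS _ _))//.
rewrite mulrCA mulrA ler_wpM2r ?rnorm_ge0//.
by rewrite ler_wpM2l// Q_neumann_norm.
Qed.

Definition compression n := bop_comp 'N_n (bop_comp A 'N_n).

Lemma compressionE n x : compression n x = 'N_n (A ('N_n x)).
Proof. by []. Qed.

Lemma compression_self_adjoint n : self_adjoint (compression n).
Proof.
apply/self_adjointP => x y.
by rewrite !compressionE neumann_rinner// sAr neumann_rinner.
Qed.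

Lemma compression_norm n x : rnorm (compression n x) <= rnorm x.
Proof.
apply: rnorm_le_of_quadratic_form => [|y].
  exact: compression_self_adjoint.
rewrite compressionE -neumann_rinner// (le_trans (A_le _))//.
by rewrite ler_sqr ?nnegrE ?rnorm_ge0// Q_neumann_norm.
Qed.

(** With the inner index frozen at [k], N_n A N_k x converges in [n] by monotonicity. Unfreezing it
    costs at most c |Q (N_n - N_k) x| = c |B^k x - B^n x|, which is small for large [k]. *)
Lemma compression_cvg x : exists l : H, (fun n => compression n x) @ \oo --> l.
Proof.
have [M BM _] := defect_pow_cvg.
have cQ n k : rnorm ('N_n (A ('N_n x)) - 'N_n (A ('N_k x))) <=
    c * (rnorm ('B^n x - M x) + rnorm ('B^k x - M x)).
  rewrite -!linearB (le_trans (neumann_A_norm _ _))// ler_wpM2l//.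
  rewrite linearB /= !Q_neumann.
  rewrite (_ : _ - _ = ('B^k x - M x) - ('B^n x - M x)).
    by rewrite (le_trans (rnormB _ _))// addrC.
  by rewrite !opprB !subrKA addrC subrKA.
apply: cauchy_rnorm => e e0.
have /cvg_rnormP/cvgr0Pnorm_lt Bx := BM x.
(* Two deviations below [d] contribute at most 2 c d <= e / 4, and c + 1 is positive even if c =
   0. *)
pose d := e / (8 * (c + 1)).
have d0 : 0 < d by rewrite divr_gt0// mulr_gt0// ltr_wpDl.
have [k _ kB] := Bx _ d0.
have [l Nl] : exists l : H, (fun n => 'N_n (A ('N_k x))) @ \oo --> l.
  by apply: neumann_cvg => n; exact: neumann_A_norm.
have e4 : 0 < e / 4 by rewrite divr_gt0.
have /cvg_rnormP/cvgr0Pnorm_lt/(_ _ e4)[N _ NN] := Nl.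
exists (maxn k N) => n; rewrite geq_max => /andP[kn Nn].
have near_l m : (N <= m)%N -> rnorm ('N_m (A ('N_k x)) - l) < e / 4.
  by move=> /NN; rewrite /= ger0_norm ?rnorm_ge0.
have near_compression m : (k <= m)%N ->
    rnorm (compression m x - 'N_m (A ('N_k x))) < e / 4.
  move=> km; have Bd j : (k <= j)%N -> rnorm ('B^j x - M x) < d.
    by move=> /kB; rewrite /= ger0_norm ?rnorm_ge0.
  rewrite compressionE (le_lt_trans (cQ _ _))//.
  have := Bd _ km; have := Bd _ (leqnn k).
  have : (c + 1) * d = e / 8 by rewrite /d; field; rewrite gt_eqF// ltr_wpDl.
  by move: c0; nra.
(* Both compressions are compared with [l] through their frozen versions: four pieces, each below e
   / 4. *)
have split4 (a b p q : H) : a - b = (a - p) + (p - l) - ((b - q) + (q - l)).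
  by rewrite !subrKA opprB subrKA.
rewrite (split4 _ _ ('N_(maxn k N) (A ('N_k x))) ('N_n (A ('N_k x)))).
rewrite (le_lt_trans (rnormB _ _))//.
have := near_l _ (leq_maxr k N); have := near_l _ Nn.
have := near_compression _ (leq_maxl k N); have := near_compression _ kn.
have := rnormD (compression (maxn k N) x - 'N_(maxn k N) (A ('N_k x)))
  ('N_(maxn k N) (A ('N_k x)) - l).
have := rnormD (compression n x - 'N_n (A ('N_k x))) ('N_n (A ('N_k x)) - l).
by lra.
Qed.

(** By symmetry <M A x, z> = <x, A M z>, and M z lies in the kernel of [Q], where [A] vanishes. *)
Lemma A_defect_pow_limit (M : bounded_operator H) x :
  (forall x, (fun n => 'B^n x) @ \oo --> M x) -> M (A x) = 0.
Proof.
move=> BM; have QM y : Q (M y) = 0.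
  have [M' BM' QM'] := defect_pow_cvg.
  by rewrite (_ : M y = M' y)//; exact: cvg_unique (BM y) (BM' y).
apply: rinner_inj => z; rewrite rinner0l.
rewrite (_ : rinner _ _ = rinner x (A (M z))).
  by rewrite A_ker_Q// rinner0r.
apply: (@cvg_unique _ _ ((fun n => rinner ('B^n (A x)) z) @ \oo)) => //.
  by apply: cvg_rinner => //; exact: cvg_cst.
rewrite (_ : (fun n => _) = (fun n => rinner x (A ('B^n z)))).
  by apply: cvg_rinner; [exact: cvg_cst | exact: bop_cvg].
by apply/funext => n; rewrite bop_pow_rinner// sAr.
Qed.

Lemma closure_limit (E : set H) (u : nat -> H) l :
  u @ \oo --> l -> (forall n, closure E (u n)) -> closure E l.
Proof.
move=> ul Eu; apply: (@closed_cvg _ _ \oo _ _ (closure E)) ul.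
  exact: closed_closure.
exact: nearW.
Qed.

(** Q^2 N_n x = Q (x - B^n x) tends to Q x, since [Q] annihilates the limit of B^n x. *)
Lemma Q_closure x : closure (range (bop_comp Q Q)) (Q x).
Proof.
have [M BM QM] := defect_pow_cvg.
apply: (@closure_limit _ (fun n => bop_comp Q Q ('N_n x))) => [|n].
  rewrite (_ : (fun n => _) = (fun n => Q (x - 'B^n x))).
    rewrite -[Q x]subr0 -(QM x) -linearB; apply: bop_cvg.
    by apply: cvgB => //; exact: cvg_cst.
  by apply/funext => n; rewrite bopE Q_neumann.
by apply: subset_closure; exists ('N_n x).
Qed.

Lemma sandwich_factor : exists X : bounded_operator H,
  [/\ self_adjoint X, range X `<=` closure (range (bop_comp Q Q)),
      forall x, rnorm (X x) <= rnorm x &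
      A = bop_comp Q (bop_comp X Q)].
Proof.
have [n x|x|X NX] := @strong_limit _ _ _ compression 1.
- by rewrite mul1r compression_norm.
- exact: compression_cvg.
have [M BM QM] := defect_pow_cvg.
have MA x := A_defect_pow_limit x BM.
exists X; split.
- by apply: self_adjoint_limit NX; exact: compression_self_adjoint.
- move=> _ [x _ <-]; apply: (closure_limit (NX x)) => n.
  rewrite compressionE.
  (* Q N_m tends to 1 - M and M A = 0, so N_n A N_n x is the limit in [m] of N_n Q N_m A N_n x.
     These vectors lie in the range of [Q], because [Q] and N_n commute. *)
  apply: (@closure_limit _ (fun m => 'N_n (Q ('N_m (A ('N_n x)))))) => [|m].
    apply: bop_cvg; rewrite -[X in _ --> X]subr0 -(MA ('N_n x)).
    rewrite (_ : (fun n => _) = (fun m => A ('N_n x) - 'B^m (A ('N_n x)))).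
      by apply: cvgB => //; exact: cvg_cst.
    by apply/funext => m; rewrite Q_neumann.
  by rewrite neumann_Q; exact: Q_closure.
- by move=> x; apply: cvg_rnorm_le (NX x) _ => n; exact: compression_norm.
apply: bop_ext => x; rewrite !bopE.
apply: (@cvg_unique _ _ ((fun n => Q (compression n (Q x))) @ \oo)) => //;
  last by apply: bop_cvg.
(* Q N_n A N_n Q = (1 - B^n) A (1 - B^n), whose strong limit is [A] because A M = 0 and M A = 0. *)
rewrite (_ : (fun n => _) =
    (fun n => A (x - 'B^n x) - 'B^n (A (x - 'B^n x)))); last first.
  by apply/funext => n; rewrite compressionE neumann_Q !Q_neumann.
have AB : (fun n => A (x - 'B^n x)) @ \oo --> A x.
  rewrite -[A x]subr0 -(A_ker_Q (QM x)) -linearB; apply: bop_cvg.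
  by apply: cvgB => //; exact: cvg_cst.
rewrite -[A x]subr0 -(MA x); apply: cvgB => //.
apply: (strong_limit_apply (c := 1) _ BM AB) => n y.
by rewrite mul1r bop_pow_norm//; exact: defect_norm.
Qed.

End ApproximateInverse.

(** * The operator norm in terms of real norms *)

Section OperatorNorm.
Variables (R : realType) (F : scalar_kind) (H : hilbertType R F).
Implicit Type T : bounded_operator H.

Lemma rnorm_le1 (x : H) : (`|x| <= 1) = (rnorm x <= 1).
Proof. by rewrite normE -real_scalar1 ler_real_scalar. Qed.

Lemma operator_norm_le1P T :
  operator_norm T <= 1 <-> forall x, rnorm (T x) <= rnorm x.
Proof.
have [c c0 Tc] := bop_bounded T.
split=> [T1 x|T1]; last first.
  apply: ge_sup; first by exists (rnorm (T 0)), 0 => //=; rewrite normr0 ler01.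
  by move=> _ [x /= + <-]; rewrite rnorm_le1; exact: le_trans (T1 x).
have [->|x0] := eqVneq x 0; first by rewrite linear0.
have {}x0 : 0 < rnorm x.
  by rewrite lt0r rnorm_ge0 andbT; apply: contra_neq x0 => /rnorm_eq0.
have xi : 0 <= (rnorm x)^-1 by rewrite invr_ge0 ltW.
(* [x] is rescaled to norm 1; boundedness of the operator makes the supremum an upper bound. *)
rewrite -[leRHS]mul1r -ler_pdivrMr// mulrC -rnormZ// -linearZ.
rewrite (le_trans _ T1)//; apply: ub_le_sup.
  exists c => _ [y /= + <-]; rewrite rnorm_le1 => y1.
  by rewrite (le_trans (Tc y))// ger_pMr.
eexists; last by [].
by rewrite /= rnorm_le1 rnormZ// mulVf// gt_eqF.
Qed.

End OperatorNorm.

(** * Even perturbations of a positive operator *)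

Theorem theorem3p1 (R : realType) (F : scalar_kind) (H : hilbertType R F)
    (sepH : separable H) (P : bounded_operator H)
    (posP : positive_operator P) (A : bounded_operator H) :
  even_perturbation (@positive_operator _ _ H) P A <->
  exists X : bounded_operator H,
    [/\ self_adjoint X,
        range X `<=` closure (range P),
        operator_norm X <= 1 &
        A = bop_comp (sqrt_operator P) (bop_comp X (sqrt_operator P))].
Proof.
have [pQ QQ] := sqrt_operatorP posP; set Q := sqrt_operator P in pQ QQ *.
have [sQ Q0] := (positive_operatorP Q).1 pQ.
have [sP _] := (positive_operatorP P).1 posP.
have QP : bop_comp Q Q = P by apply: bop_ext.
have PE x y : rinner x (P y) = rinner (Q x) (Q y) by rewrite -QQ sQ.
split=> [[/positive_operatorP[sPA PA0] /positive_operatorP[_ MA0]]|].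
- have sA : self_adjoint A.
    apply/self_adjointP => x y; have := sPA x y.
    by rewrite !bopE rinnerDl rinnerDr sP => /addrI.
  have A_le x : `|rinner x (A x)| <= rnorm (Q x) ^+ 2.
    have := PA0 x; have := MA0 x; rewrite !bopE !(rinnerDr, rinnerNr) PE.
    by rewrite rinner_norm ler_norml => ? ?; apply/andP; split; lra.
  (* The constant is 2 + 1: A = (P + A) - P, where Cauchy-Schwarz for the positive form of P + A, at
     most 2 |Q z|^2 on the diagonal, gives 2, and <x, P y> = <Q x, Q y> gives 1. *)
  have A_CS x y : `|rinner x (A y)| <= 3 * rnorm (Q x) * rnorm (Q y).
    have pPA : positive_operator (P + A) by apply/positive_operatorP.
    have PA2 z : rinner z ((P + A) z) <= 2 * rnorm (Q z) ^+ 2.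
      rewrite bopE rinnerDr PE rinner_norm.
      by have := A_le z; rewrite ler_norml => /andP[]; lra.
    have PAxy : `|rinner x ((P + A) y)| <= 2 * rnorm (Q x) * rnorm (Q y).
      rewrite -ler_sqr ?nnegrE ?mulr_ge0 ?rnorm_ge0// real_normK ?num_real//.
      rewrite (le_trans (positive_CS x y pPA))//.
      rewrite (le_trans (ler_pM _ _ (PA2 x) (PA2 y)))//.
      by rewrite -subr_ge0 (_ : _ - _ = 0)//; ring.
    have := rinner_CS (Q x) (Q y); rewrite -PE.
    move: PAxy; rewrite bopE rinnerDr !ler_norml.
    by move=> /andP[? ?] /andP[? ?]; apply/andP; split; lra.
  have [c cgt0 Qc] := bop_bounded Q.
  have rQ x : c^-1 * rinner x (Q x) <= rnorm x ^+ 2.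
    rewrite ler_pdivrMl// (le_trans (ler_norm _))//.
    rewrite (le_trans (rinner_CS _ _))// expr2 mulrCA.
    by rewrite ler_wpM2l ?rnorm_ge0.
  have c1 : 0 < c^-1 by rewrite invr_gt0.
  have [X [sX rX X1 AE]] :=
    sandwich_factor pQ c1 rQ sA A_le (ler0n _ 3) A_CS.
  exists X; split=> //; first by rewrite -QP.
  exact/operator_norm_le1P.
move=> [X [/self_adjointP sX _ /operator_norm_le1P X1 AE]].
have AxE x y : rinner x (A y) = rinner (Q x) (X (Q y)).
  by rewrite AE !bopE sQ.
(* |<Q x, X Q x>| <= |Q x|^2 = <x, P x>, which makes both P + A and P - A nonnegative. *)
have A_le x : `|rinner x (A x)| <= rinner x (P x).
  rewrite AxE PE rinner_norm (le_trans (rinner_CS _ _))// expr2.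
  by rewrite ler_wpM2l ?rnorm_ge0.
have sA x y : rinner (A x) y = rinner x (A y).
  by rewrite AxE rinnerC AxE -sX rinnerC.
split; apply/positive_operatorP; split=> [x y|x]; rewrite !bopE.
- by rewrite rinnerDl rinnerDr sP sA.
- by rewrite rinnerDr; have := A_le x; rewrite ler_norml => /andP[]; lra.
- by rewrite rinnerBl rinnerBr sP sA.
- by rewrite rinnerBr; have := A_le x; rewrite ler_norml => /andP[]; lra.
Qed.
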